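(* Consider the two phase problem ($N=2$), with $K$, $P_2$, $P_3$, ${\cal K}_1$, ${\bf m}_1$ as defined in the context. The right preconditioners $P_2$ and $P_3$ are identical. Moreover, the resulting preconditioned system $KP_i^{-1}$, $i=2,3$, is a lower triangular matrix whose diagonal entries are all equal to $1$ except for a solitary diagonal entry (in the row and column of the single unknown $\lambda$) equal to $$ a = \frac{{\bf m}_1^T {\cal K}_1^{-1} {\bf m}_1}{\left({\bf m}_1^T{\bf m}_1\right)\left({\bf m}_1^T{\cal K}_1{\bf m}_1\right)^{-1}\left({\bf m}_1^T{\bf m}_1\right)}. $$ Furthermore, the minimal polynomial of $KP_i^{-1}$, $i=2,3$, is of degree three, and hence right preconditioned GMRES applied to $K\mathbf{x}=\mathbf{b}$ with preconditioner $P_i$ converges (in exact arithmetic, to the exact solution) within three iterations.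
   Context: **Finite element setting.** $\Omega\subset\mathbb{R}^d$, $d\in\{1,2,3\}$, is a bounded polyhedral domain with a regular triangulation $\mathcal{T}_h$ into disjoint open simplices. $\mathcal{J}$ is the (finite) set of nodes, with coordinates $\mathbf{p}_j$, and $\{\chi_j\}_{j\in\mathcal{J}}$ is the standard nodal basis of the space $S_h$ of continuous piecewise affine functions on $\mathcal{T}_h$. $I_h:C^0(\overline\Omega)\to S_h$ is nodal interpolation, and $(f,g)_h:=\int_\Omega I_h(fg)\,\mathrm{d}x$. The lumped mass matrix is $M=(m_{ij})$ with $m_{ij}=(\chi_i,\chi_j)_h$; it is diagonal with positive entries $M_j=(\chi_j,\chi_j)_h$. The stiffness matrix is $L=(l_{ij})$ with $l_{ij}=\int_\Omega\nabla\chi_j\cdot\nabla\chi_i\,\mathrm{d}x$. The constants $\varepsilon>0$ and $\tau>0$ are the interface parameter and the time step. **Linear system for two phases.** At an iteration of the primal-dual active set method, there is for each phase $i$ a set $\mathcal{I}_i\subset\mathcal{J}$ of inactive nodes, and the interface set of phase $i$ is $\mathcal{D}_i=\mathcal{I}_i\cap\bigcup_{j\neq i}\mathcal{I}_j$. For $N=2$ this gives $\mathcal{D}_1=\mathcal{D}_2=\mathcal{I}_1\cap\mathcal{I}_2=:\mathcal{D}$, a nonempty set; write $n=|\mathcal{D}|$. Define - ${\cal K}_1:=\frac{\varepsilon^2}{\tau}(m_{rj})_{r,j\in\mathcal{D}}+\varepsilon^2(l_{rj})_{r,j\in\mathcal{D}}\in\mathbb{R}^{n\times n}$ (symmetric positive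 definite) and ${\cal K}:=\begin{bmatrix}{\cal K}_1&0\\0&{\cal K}_1\end{bmatrix}$; - ${\bf m}_1:=(M_j)_{j\in\mathcal{D}}\in\mathbb{R}^n$ (column vector) and $M_1:=\mathrm{diag}(M_j)_{j\in\mathcal{D}}\in\mathbb{R}^{n\times n}$; - ${\cal B}_1:=[-{\bf m}_1^T\ \ {\bf m}_1^T]\in\mathbb{R}^{1\times 2n}$, ${\cal B}_2:=[-M_1\ \ -M_1]\in\mathbb{R}^{n\times 2n}$, and $B:=\begin{bmatrix}{\cal B}_1\\{\cal B}_2\end{bmatrix}$. The system matrix, acting on the unknowns ordered as $[\mathbf{u}_1,\mathbf{u}_2,\lambda,\Lambda]\in\mathbb{R}^n\times\mathbb{R}^n\times\mathbb{R}\times\mathbb{R}^n$, is $$K:=\begin{bmatrix}{\cal K}&{\cal B}_1^T&{\cal B}_2^T\\{\cal B}_1&0&0\\{\cal B}_2&0&0\end{bmatrix}.$$ **Preconditioners.** Let $D_{ij}:={\cal B}_i{\cal B}_j^T$ for $i,j\in\{1,2\}$ and $D:=BB^T=\begin{bmatrix}D_{11}&D_{12}\\ D_{21}&D_{22}\end{bmatrix}$. Define $${\cal S}_2:=\begin{bmatrix}D_{11}({\cal B}_1{\cal K}{\cal B}_1^T)^{-1}D_{11}&0\\0&D_{22}({\cal B}_2{\cal K}{\cal B}_2^T)^{-1}D_{22}\end{bmatrix},\qquad {\cal S}_3:=D(B{\cal K}B^T)^{-1}D,$$ $$P_i:=\begin{bmatrix}{\cal K}&B^T\\0&-{\cal S}_i\end{bmatrix},\quad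 i=2,3.$$ **GMRES.** Right preconditioned GMRES with preconditioner $P$ applied to $K\mathbf{x}=\mathbf{b}$ with initial guess $\mathbf{x}_0$ and $\mathbf{r}_0=\mathbf{b}-K\mathbf{x}_0$ produces at step $k$ the iterate $\mathbf{x}_k\in\mathbf{x}_0+P^{-1}\,\mathrm{span}\{\mathbf{r}_0,(KP^{-1})\mathbf{r}_0,\dots,(KP^{-1})^{k-1}\mathbf{r}_0\}$ minimizing $\|\mathbf{b}-K\mathbf{x}_k\|_2$. Convergence within three iterations means that, for every $\mathbf{b}$ and $\mathbf{x}_0$, $\mathbf{b}-K\mathbf{x}_k=0$ for some $k\le 3$.
   Formalization: The minimal polynomial is claimed to be of degree three only when a ≠ 1, and of degree at most three in general; if a = 1 (for example whenever n = 1) the degree is two, so the claim as worded fails there. *)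

(* Defs.v *)
From HB Require Import structures.
From mathcomp Require Import all_boot all_order all_algebra.
From mathcomp Require Import all_classical all_reals all_analysis.

Set Implicit Arguments.
Unset Strict Implicit.
Unset Printing Implicit Defensive.

Import Order.TTheory GRing.Theory Num.Theory.
Import numFieldNormedType.Exports.

Local Open Scope classical_set_scope.
Local Open Scope ring_scope.

Section Integration.
Context {R : realType}.

Definition point_of d (s : seq R) : 'rV[R]_d := \row_(i < d) s`_i.

Local Notation leb := (@lebesgue_measure R).

(* MathComp-Analysis has no Lebesgue measure on 'rV[R]_d. For d = 1, 2, 3 we
   integrate against the (product) Lebesgue measure on R, R * R, (R * R) * R
   through the coordinate bijection; the value for other d is a dummy. *)
Definition integral_Rd d (A : set 'rV[R]_d) (f : 'rV[R]_d -> R) : R :=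
  match d with
  | 1%N => \int[leb]_(x in [set x | A (point_of d [:: x])])
            f (point_of d [:: x])
  | 2%N => \int[(leb \x leb)%E]_(x in [set x | A (point_of d [:: x.1; x.2])])
            f (point_of d [:: x.1; x.2])
  | 3%N => \int[(leb \x leb \x leb)%E]_(x in
              [set x | A (point_of d [:: x.1.1; x.1.2; x.2])])
            f (point_of d [:: x.1.1; x.1.2; x.2])
  | _ => 0
  end.

End Integration.

Section FiniteElements.
Context {R : realType} {d : nat} {J : finType}.
Implicit Types (Omega : set 'rV[R]_d) (p : J -> 'rV[R]_d) (t : {set J})
  (Th : {set {set J}}) (v : 'rV[R]_d -> R) (chi : J -> 'rV[R]_d -> R).

Definition open_simplex p t : set 'rV[R]_d :=
  [set x | exists w : J -> R,
     [/\ forall j, j \in t -> 0 < w j, \sum_(j in t) w j = 1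
       & x = \sum_(j in t) w j *: p j]].

Definition closed_simplex p t : set 'rV[R]_d :=
  [set x | exists w : J -> R,
     [/\ forall j, j \in t -> 0 <= w j, \sum_(j in t) w j = 1
       & x = \sum_(j in t) w j *: p j]].

Definition affinely_independent p t : Prop :=
  forall w : J -> R, \sum_(j in t) w j = 0 -> \sum_(j in t) w j *: p j = 0 ->
  forall j, j \in t -> w j = 0.

(* A simplex is given by its set of d + 1 vertices, and J is exactly the set
   of vertices of the triangulation. Conformity implies that distinct open
   simplices are disjoint; closure_domain and the finiteness of Th imply that
   Omega is bounded and polyhedral. *)
Record regular_triangulation Omega p Th : Prop := {
  domain_open : open Omega;
  domain_connected : connected Omega;
  nodes_inj : injective p;
  nodes_cover : forall j : J, exists2 t, t \in Th & j \in t;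
  simplex_card : forall t, t \in Th -> #|t| = d.+1;
  simplex_nondeg : forall t, t \in Th -> affinely_independent p t;
  conforming : forall t t', t \in Th -> t' \in Th ->
    closed_simplex p t `&` closed_simplex p t' = closed_simplex p (t :&: t')%SET;
  simplex_sub : forall t, t \in Th -> open_simplex p t `<=` Omega;
  closure_domain :
    closure Omega = [set x | exists2 t, t \in Th & closed_simplex p t x]
}.

(* The elements of S_h are functions on the closure of Omega; values outside
   it are irrelevant. *)
Definition Sh Omega p Th : set ('rV[R]_d -> R) :=
  [set v | {within closure Omega, continuous v} /\
     forall t, t \in Th -> exists (g : 'rV[R]_d) (c : R),
       forall x, closed_simplex p t x -> v x = \sum_(k < d) g 0 k * x 0 k + c].

Definition nodal_basis Omega p Th chi : Prop :=
  (forall j, Sh Omega p Th (chi j)) /\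
  (forall i j, chi j (p i) = (i == j)%:R).

Definition interp p chi (f : 'rV[R]_d -> R) : 'rV[R]_d -> R :=
  fun x => \sum_j f (p j) * chi j x.

Definition lumped_product Omega p chi (f g : 'rV[R]_d -> R) : R :=
  integral_Rd Omega (interp p chi (fun x => f x * g x)).

(* The gradient of a member of S_h exists on the open simplices; on the
   remaining null set of Omega it is set to 0. *)
Definition gradh p Th v (x : 'rV[R]_d) : 'rV[R]_d :=
  if `[< exists2 t, t \in Th & open_simplex p t x >]
  then \row_(k < d) 'D_(delta_mx 0 k) v x
  else 0.

Definition mass Omega p chi (i j : J) : R :=
  lumped_product Omega p chi (chi i) (chi j).

Definition stiffness Omega p Th chi (i j : J) : R :=
  integral_Rd Omega (fun x =>
    \sum_(k < d) gradh p Th (chi j) x 0 k * gradh p Th (chi i) x 0 k).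

(* calK_1 and m_1 for an interface set D; the nodes of D are numbered by
   enum_val. *)
Definition calK1 Omega p Th chi (eps tau : R) (D : {set J}) : 'M[R]_#|D| :=
  eps ^+ 2 / tau *:
    (\matrix_(r, j) mass Omega p chi (enum_val r) (enum_val j))
  + eps ^+ 2 *:
    (\matrix_(r, j) stiffness Omega p Th chi (enum_val r) (enum_val j)).

Definition lumped_vec Omega p chi (D : {set J}) : 'cV[R]_#|D| :=
  \col_j mass Omega p chi (enum_val j) (enum_val j).

End FiniteElements.

Section SaddlePoint.
Context {R : fieldType} {n : nat}.

Definition calK (K1 : 'M[R]_n) : 'M[R]_(n + n) := block_mx K1 0 0 K1.

Definition calB1 (m1 : 'cV[R]_n) : 'M[R]_(1, n + n) := row_mx (- m1^T) m1^T.

Definition calB2 (m1 : 'cV[R]_n) : 'M[R]_(n, n + n) :=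
  row_mx (- diag_mx m1^T) (- diag_mx m1^T).

Definition Bmx (m1 : 'cV[R]_n) : 'M[R]_(1 + n, n + n) :=
  col_mx (calB1 m1) (calB2 m1).

Definition Kmx (K1 : 'M[R]_n) (m1 : 'cV[R]_n) : 'M[R]_((n + n) + (1 + n)) :=
  block_mx (calK K1) (row_mx (calB1 m1)^T (calB2 m1)^T)
           (col_mx (calB1 m1) (calB2 m1)) 0.

Definition Dmx (m1 : 'cV[R]_n) : 'M[R]_(1 + n) := Bmx m1 *m (Bmx m1)^T.

Definition S2 (K1 : 'M[R]_n) (m1 : 'cV[R]_n) : 'M[R]_(1 + n) :=
  let D11 := calB1 m1 *m (calB1 m1)^T in
  let D22 := calB2 m1 *m (calB2 m1)^T in
  block_mx (D11 *m invmx (calB1 m1 *m calK K1 *m (calB1 m1)^T) *m D11) 0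
           0 (D22 *m invmx (calB2 m1 *m calK K1 *m (calB2 m1)^T) *m D22).

Definition S3 (K1 : 'M[R]_n) (m1 : 'cV[R]_n) : 'M[R]_(1 + n) :=
  Dmx m1 *m invmx (Bmx m1 *m calK K1 *m (Bmx m1)^T) *m Dmx m1.

Definition precond (K1 : 'M[R]_n) (m1 : 'cV[R]_n) (S : 'M[R]_(1 + n)) :
    'M[R]_((n + n) + (1 + n)) :=
  block_mx (calK K1) (Bmx m1)^T 0 (- S).

(* invmx A is A itself when A is singular; this says that every matrix inverted
   in the two preconditioners, in acoef and in Kmx *m invmx P is invertible. *)
Definition inverses_exist (K1 : 'M[R]_n) (m1 : 'cV[R]_n) : Prop :=
  [/\ K1 \in unitmx,
      calB1 m1 *m calK K1 *m (calB1 m1)^T \in unitmx,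
      calB2 m1 *m calK K1 *m (calB2 m1)^T \in unitmx,
      Bmx m1 *m calK K1 *m (Bmx m1)^T \in unitmx
    & precond K1 m1 (S2 K1 m1) \in unitmx /\
      precond K1 m1 (S3 K1 m1) \in unitmx].

Definition acoef (K1 : 'M[R]_n) (m1 : 'cV[R]_n) : R :=
  let mm := (m1^T *m m1) 0 0 in
  (m1^T *m invmx K1 *m m1) 0 0 / (mm * ((m1^T *m K1 *m m1) 0 0)^-1 * mm).

(* The position of the unknown lambda in [u_1, u_2, lambda, Lambda]. *)
Definition lambda_index : 'I_((n + n) + (1 + n)) :=
  rshift (n + n) (lshift n ord0).

(* mxminpoly is only available for sizes that are syntactically successors. *)
Definition minpoly (A : 'M[R]_((n + n) + (1 + n))) : {poly R} :=
  mxminpoly (castmx (addnS (n + n) n, addnS (n + n) n) A).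

End SaddlePoint.

Section GMRES.
Context {R : realType} {N : nat}.
Implicit Types (K P : 'M[R]_N) (b x : 'cV[R]_N).

Definition norm2 x : R := Num.sqrt (\sum_(i < N) x i 0 ^+ 2).

Definition search_space K P b x0 (k : nat) : set 'cV[R]_N :=
  [set x | exists c : 'I_k -> R,
     x = x0 + invmx P *m
       \sum_(i < k) c i *: iter i (mulmx (K *m invmx P)) (b - K *m x0)].

Definition gmres_iterate K P b x0 (k : nat) x : Prop :=
  search_space K P b x0 k x /\
  forall y, search_space K P b x0 k y ->
    norm2 (b - K *m x) <= norm2 (b - K *m y).

Definition gmres_converges_within K P (m : nat) : Prop :=
  forall b x0, exists k : nat,
    [/\ (k <= m)%N, exists x, gmres_iterate K P b x0 k x
      & forall x, gmres_iterate K P b x0 k x -> b - K *m x = 0].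

End GMRES.

(* Main.v *)
(* With A := calK_1 and M := diag(m), the rows of B_1 = [-m^T, m^T] are odd and
   those of B_2 = [-M, -M] are even under exchange of the two phases, so
   B diag(X, X) B^T = 2 diag(m^T X m, M X M) for every X. Taking X = 1, A and
   A^-1 gives S_2 = S_3 and
     K P^-1 = [1, 0; B diag(A, A)^-1, diag(a, 1)],
   hence (K P^-1 - 1)^2 (K P^-1 - a) = 0. Since a > 0, this cubic relation
   exhibits the inverse of K P^-1 as a quadratic polynomial in K P^-1, so the
   third Krylov space contains the exact solution.
   What has to be taken from the finite elements is that m has positive entries
   and that A is positive definite: chi_i > 1/2 on a cube inside Omega, and the
   stiffness matrix is a Gram matrix of bounded, piecewise constant gradients. *)

Require Import Defs.
From mathcomp Require Import all_boot all_order all_algebra.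
From mathcomp Require Import all_classical all_reals all_analysis.
From mathcomp Require Import measurable_realfun ring lra.

Set Implicit Arguments.
Unset Strict Implicit.
Unset Printing Implicit Defensive.

Import Order.TTheory GRing.Theory Num.Theory.
Import numFieldNormedType.Exports.

Local Open Scope classical_set_scope.
Local Open Scope ring_scope.

(** * Degree of the minimal polynomial from relations between powers *)

Section MinimalPolynomial.
Context {F : fieldType}.

(** Powers appear as iterates because [N] is a successor only through [e]. Once [N] is replaced they
    are ring powers, and the minimal polynomial divides the annihilating [q]. *)
Lemma size_mxminpoly_castmx_le (N N' : nat) (e : N = N'.+1) (A : 'M[F]_N)
    (q : {poly F}) :
  q != 0 -> \sum_(i < size q) q`_i *: iter i (mulmx A) 1%:M = 0 ->
  (size (mxminpoly (castmx (e, e) A)) <= size q)%N.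
Proof.
move: (e) A; rewrite {}e => e A q0 qA; rewrite castmx_id.
apply: dvdp_leq => //; apply: mxminpoly_min.
rewrite -[q]coefK poly_def rmorph_sum /= -[RHS]qA; apply: eq_bigr => i _.
rewrite linearZ /= rmorphXn /= horner_mx_X; congr (_ *: _).
by elim: (i : nat) => [|k IH] //=; rewrite exprS IH.
Qed.

(** A minimal polynomial of size at most [m] would be a vanishing combination of the first [m]
    powers, hence zero by independence, although it is monic. *)
Lemma size_mxminpoly_castmx_gt (N N' : nat) (e : N = N'.+1) (A : 'M[F]_N)
    (m : nat) :
  (forall c : 'I_m -> F, \sum_(i < m) c i *: iter i (mulmx A) 1%:M = 0 ->
     forall i, c i = 0) ->
  (m < size (mxminpoly (castmx (e, e) A)))%N.
Proof.
move: (e) A; rewrite {}e => e A indep; rewrite castmx_id.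
rewrite ltnNge; apply/negP => szm.
have := mx_root_minpoly A; have := mxminpoly_monic A.
set q := mxminpoly A in szm *; move=> qmon qA.
have q0 : q = 0.
  apply/polyP => i; rewrite coef0.
  have [im|mi] := ltnP i m; last by rewrite nth_default // (leq_trans szm).
  apply: (indep (fun i : 'I_m => q`_i) _ (Ordinal im)); rewrite -[RHS]qA.
  have -> : q = \poly_(i < m) q`_i.
    apply/polyP => k; rewrite coef_poly; case: ltnP => // mk.
    by rewrite nth_default // (leq_trans szm).
  rewrite poly_def rmorph_sum /=; apply: eq_bigr => k _.
  rewrite linearZ /= rmorphXn /= horner_mx_X -poly_def coef_poly ltn_ord.
  congr (_ *: _); by elim: (k : nat) => [|l IH] //=; rewrite exprS IH.
by move: qmon; rewrite q0 monicE lead_coef0 eq_sym oner_eq0.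
Qed.

End MinimalPolynomial.

(** * GMRES with right preconditioning *)

Section Gmres.
Context {R : realType} {N : nat}.
Implicit Types (K P : 'M[R]_N) (b x : 'cV[R]_N).

Lemma norm2_le0 x : norm2 x <= 0 -> x = 0.
Proof.
rewrite -sqrtr0 ler_psqrt ?qualifE /= ?sumr_ge0 // => [le0|i _]; last exact: sqr_ge0.
have : \sum_(i < N) x i 0 ^+ 2 == 0.
  by rewrite eq_le le0 sumr_ge0 // => i _; exact: sqr_ge0.
rewrite psumr_eq0 => [/allP x0|i _]; last exact: sqr_ge0.
apply/colP => i; have := x0 i (mem_index_enum _).
by rewrite sqrf_eq0 mxE => /eqP.
Qed.

Lemma norm20 : norm2 (0 : 'cV[R]_N) = 0.
Proof. by rewrite /norm2 big1 ?sqrtr0 // => i _; rewrite mxE expr0n. Qed.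

(** The relation makes $\sum_i c_i T^i$ an inverse of [T], so applying it to the initial residual
    gives a point of the search space with residual 0. Every minimizer then has residual norm at
    most 0. *)
Lemma gmres_converges_polynomial_inverse K P m (c : 'I_m -> R) :
  P \in unitmx ->
  let T := K *m invmx P in
  \sum_(i < m) c i *: iter i.+1 (mulmx T) 1%:M = 1%:M ->
  gmres_converges_within K P m.
Proof.
move=> Pu T cT b x0.
pose r0 := b - K *m x0.
have itE i (r : 'cV[R]_N) : iter i (mulmx T) r = iter i (mulmx T) 1%:M *m r.
  by elim: i => [|i IH]; rewrite ?mul1mx //= IH mulmxA.
pose z := x0 + invmx P *m \sum_(i < m) c i *: iter i (mulmx T) r0.
have zres : b - K *m z = 0.
  rewrite /z mulmxDr opprD addrA -/r0 mulmxA -/T mulmx_sumr.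
  rewrite -{1}[r0]mul1mx -cT mulmx_suml -sumrB big1 // => i _.
  by rewrite -scalemxAr -scalemxAl -itE /= subrr.
have zsp : search_space K P b x0 m z by exists c.
exists m; split=> //.
  exists z; split=> // y _; rewrite zres norm20 sqrtr_ge0 //.
by move=> x [_ /(_ _ zsp)]; rewrite zres norm20 => /norm2_le0.
Qed.

End Gmres.

(** * Positive definiteness and the two Schur complement approximations *)

Section Saddle.
Context {R : realFieldType} {n : nat} (K1 : 'M[R]_n) (m1 : 'cV[R]_n).

Definition posdef (A : 'M[R]_n) : Prop :=
  forall u : 'cV[R]_n, u != 0 -> 0 < (u^T *m A *m u) 0 0.

Lemma posdef_unitmx (A : 'M[R]_n) : posdef A -> A \in unitmx.
Proof.
move=> Apos; rewrite -row_free_unit -kermx_eq0; apply: contraT => kn0.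
have /rowV0Pn [v vk v0] := kn0.
have vA : v *m A = 0 by apply/sub_kermxP.
have vT0 : v^T != 0 by rewrite -trmx0 (inj_eq (can_inj (@trmxK _ _ _))).
by have := Apos _ vT0; rewrite trmxK vA mul0mx mxE ltxx.
Qed.

Lemma posdef_invmx (A : 'M[R]_n) : posdef A -> posdef (invmx A).
Proof.
move=> Apos u u0; have Au := posdef_unitmx Apos.
have y0 : invmx A *m u != 0.
  by apply: contraNneq u0 => y0; rewrite -[u](mulKVmx Au) y0 mulmx0.
have := Apos _ y0.
(* [A] may be nonsymmetric, so the two quadratic forms agree only after transposing a 1 by 1
   matrix. *)
suff -> : (invmx A *m u)^T *m A *m (invmx A *m u) = (u^T *m invmx A *m u)^T.
  by rewrite mxE.
by rewrite !trmx_mul trmxK -!mulmxA (mulKVmx Au).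
Qed.

Hypothesis n_gt0 : (0 < n)%N.
Hypothesis K1pos : posdef K1.
Hypothesis m1pos : forall i, 0 < m1 i 0.

Let M1 := diag_mx m1^T.
Let mKm : R := (m1^T *m K1 *m m1) 0 0.
Let mKVm : R := (m1^T *m invmx K1 *m m1) 0 0.
Let mm : R := (m1^T *m m1) 0 0.

Lemma lumped_mx_unit : M1 \in unitmx.
Proof.
rewrite unitmxE det_diag unitfE; apply/prodf_neq0 => i _.
by rewrite mxE gt_eqF.
Qed.

Let K1u : K1 \in unitmx := posdef_unitmx K1pos.

Lemma m1_neq0 : m1 != 0.
Proof.
apply/eqP => m10; have := m1pos (Ordinal n_gt0).
by rewrite m10 mxE ltxx.
Qed.

Lemma m1_K1_m1_gt0 : 0 < mKm. Proof. exact: K1pos m1_neq0. Qed.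

Lemma m1_invK1_m1_gt0 : 0 < mKVm.
Proof. exact: posdef_invmx K1pos _ m1_neq0. Qed.

Lemma m1_m1_gt0 : 0 < mm.
Proof.
rewrite /mm mxE (bigD1 (Ordinal n_gt0)) //= ltr_wpDr //.
  by apply: sumr_ge0 => i _; rewrite mxE -expr2 sqr_ge0.
by rewrite mxE mulr_gt0.
Qed.

Lemma Bmx_calK_tr (A : 'M[R]_n) :
  Bmx m1 *m calK A *m (Bmx m1)^T =
  block_mx (2 * (m1^T *m A *m m1) 0 0)%:M 0 0 (2 *: (M1 *m A *m M1)).
Proof.
have trN p q (C : 'M[R]_(p, q)) : (- C)^T = - C^T by rewrite linearN.
rewrite /Bmx /calB1 /calB2 /calK tr_col_mx !tr_row_mx !trN trmxK tr_diag_mx -/M1.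
rewrite mul_col_mx !mul_row_block !mulmx0 !addr0 !add0r mul_col_row !mul_row_col.
(* The two phases cancel in the mixed blocks ([subrr]) and double in the diagonal ones
   ([mulr2n]). *)
rewrite !mulNmx !mulmxN !opprK !subrr -!mulr2n.
by rewrite -scale_scalar_mx -mx11_scalar !scaler_nat.
Qed.

Lemma calK_unit (A : 'M[R]_n) : A \in unitmx -> calK A \in unitmx.
Proof. by move=> Au; rewrite block_diag_mx_unit Au. Qed.

Lemma calK_inv (A : 'M[R]_n) : A \in unitmx -> invmx (calK A) = calK (invmx A).
Proof. by move=> Au; rewrite invmx_block_diag // calK_unit. Qed.

(** Closed form shared by [S2] and [S3]. *)
Let S : 'M[R]_(1 + n) :=
  block_mx (2 * (mm * mKm^-1 * mm))%:M 0 0 (2 *: (M1 *m invmx K1 *m M1)).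

Let unitmx_scale2 p (A : 'M[R]_p) : A \in unitmx -> 2 *: A \in unitmx.
Proof. by rewrite unitmxZ // unitfE pnatr_eq0. Qed.

Lemma schur_unit : S \in unitmx.
Proof.
rewrite block_diag_mx_unit; apply/andP; split.
  rewrite unitmxE det_scalar expr1 unitfE mulf_neq0 ?pnatr_eq0 //.
  by rewrite !mulf_neq0 ?invr_eq0 ?gt_eqF ?m1_m1_gt0 ?m1_K1_m1_gt0.
by rewrite unitmx_scale2 // !unitmx_mul lumped_mx_unit unitmx_inv K1u.
Qed.

Lemma Bmx_calK_tr_unit : Bmx m1 *m calK K1 *m (Bmx m1)^T \in unitmx.
Proof.
rewrite Bmx_calK_tr block_diag_mx_unit; apply/andP; split.
  rewrite unitmxE det_scalar expr1 unitfE.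
  by rewrite mulf_neq0 ?pnatr_eq0 // gt_eqF ?m1_K1_m1_gt0.
by rewrite unitmx_scale2 // !unitmx_mul lumped_mx_unit K1u.
Qed.

Lemma calK_1 : calK (1%:M : 'M[R]_n) = 1%:M.
Proof. by rewrite /calK -scalar_mx_block. Qed.

Lemma DmxE : Dmx m1 = block_mx (2 * mm)%:M 0 0 (2 *: (M1 *m M1)).
Proof. by have := Bmx_calK_tr 1%:M; rewrite calK_1 !mulmx1. Qed.

Lemma invmx_M1_K1_M1 :
  invmx (M1 *m K1 *m M1) = invmx M1 *m invmx K1 *m invmx M1.
Proof.
have u : M1 *m K1 *m M1 \in unitmx by rewrite !unitmx_mul lumped_mx_unit K1u.
apply: (can_inj (mulKmx u)); rewrite mulmxV // -!mulmxA.
by rewrite (mulKVmx lumped_mx_unit) (mulKVmx K1u) mulmxV // lumped_mx_unit.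
Qed.

(** [M1] is square and invertible, so it cancels and this block is the exact Schur complement ${\cal
    B}_2{\cal K}^{-1}{\cal B}_2^T$. The vector [m1] in the [lambda] block allows no such
    cancellation, which is where [a] comes from. *)
Lemma schur_LambdaE :
  2 *: (M1 *m M1) *m invmx (2 *: (M1 *m K1 *m M1)) *m (2 *: (M1 *m M1)) =
  2 *: (M1 *m invmx K1 *m M1).
Proof.
rewrite invmxZ ?unitmx_scale2 ?unitmx_mul ?lumped_mx_unit ?K1u // invmx_M1_K1_M1.
rewrite -!scalemxAl -!scalemxAr -!scalemxAl scalerA mulfV ?pnatr_eq0 // scale1r.
congr (_ *: _); rewrite -!mulmxA.
by rewrite (mulKVmx lumped_mx_unit) (mulKmx lumped_mx_unit).
Qed.

Lemma schur_lambdaE : (2 * mm)%:M *m invmx (2 * mKm)%:M *m (2 * mm)%:M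
  = (2 * (mm * mKm^-1 * mm))%:M :> 'M[R]_1.
Proof.
rewrite invmx_scalar -!scalar_mxM; congr _%:M; rewrite invfM; field.
by rewrite gt_eqF ?m1_K1_m1_gt0.
Qed.

Lemma S3E : S3 K1 m1 = S.
Proof.
have := Bmx_calK_tr_unit; rewrite /S3 DmxE Bmx_calK_tr => Su.
rewrite invmx_block_diag // !mulmx_block !(mulmx0, mul0mx, addr0, add0r).
by rewrite schur_lambdaE schur_LambdaE.
Qed.

Lemma calB_calK_tr (A : 'M[R]_n) :
  calB1 m1 *m calK A *m (calB1 m1)^T = (2 * (m1^T *m A *m m1) 0 0)%:M /\
  calB2 m1 *m calK A *m (calB2 m1)^T = 2 *: (M1 *m A *m M1).
Proof.
have := Bmx_calK_tr A; rewrite /Bmx tr_col_mx mul_col_mx mul_col_row.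
by move/eq_block_mx => [].
Qed.

Lemma S2E : S2 K1 m1 = S.
Proof.
have [D1 D2] := calB_calK_tr 1%:M; have [E1 E2] := calB_calK_tr K1.
move: D1 D2; rewrite calK_1 !mulmx1 => D1 D2.
by rewrite /S2 D1 D2 E1 E2 schur_lambdaE schur_LambdaE.
Qed.

(** * The preconditioned matrix and its minimal polynomial *)

Let P := precond K1 m1 S.

Lemma precond_unit : P \in unitmx.
Proof.
rewrite unitmxE det_ublock unitrM -!unitmxE calK_unit //.
by rewrite -scaleN1r unitmxZ ?unitrN1 // schur_unit.
Qed.

Lemma inverses_existP : inverses_exist K1 m1.
Proof.
have := Bmx_calK_tr_unit; rewrite {1}Bmx_calK_tr block_diag_mx_unit.
have [E1 E2] := calB_calK_tr K1; rewrite -E1 -E2 => /andP [u1 u2].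
by split=> //; rewrite ?Bmx_calK_tr_unit // S2E S3E precond_unit.
Qed.

Lemma acoefE : acoef K1 m1 = mKVm / (mm * mKm^-1 * mm).
Proof. by []. Qed.

Let a := acoef K1 m1.
Let E : 'M[R]_(1 + n) := block_mx a%:M 0 0 1%:M.
Let C := Bmx m1 *m invmx (calK K1).

Lemma acoef_gt0 : 0 < a.
Proof.
rewrite /a acoefE !(divr_gt0, mulr_gt0) ?invr_gt0 ?m1_m1_gt0 ?m1_K1_m1_gt0 //.
exact: m1_invK1_m1_gt0.
Qed.

(** Multiplying by [P] leaves one nontrivial block equation, $CB^T = ES$. Its left side is the exact
    Schur complement, and [a] is the ratio of the [lambda] entries of $CB^T$ and [S]. *)
Lemma preconditioned_systemE : Kmx K1 m1 *m invmx P = block_mx 1%:M 0 C E.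
Proof.
apply: (can_inj (mulmxK precond_unit)); rewrite mulmxKV ?precond_unit //.
rewrite /P /precond mulmx_block !mul1mx !mul0mx !mulmx0 !addr0.
rewrite /C mulmxKV ?calK_unit // calK_inv // Bmx_calK_tr.
rewrite /Kmx -tr_col_mx; congr block_mx.
rewrite mulmxN /S /E mulmx_block !(mulmx0, mul0mx, addr0, add0r) mul1mx.
rewrite -scalar_mxM -/M1 opp_block_mx add_block_mx !oppr0 !addr0 subrr.
rewrite -raddfB /= -/mKVm (_ : _ - _ = 0) ?raddf0 ?block_mx0 //.
by rewrite /a acoefE; field; rewrite !gt_eqF ?m1_K1_m1_gt0 ?m1_m1_gt0.
Qed.

Let T := Kmx K1 m1 *m invmx P.

Lemma preconditioned_trig : is_trig_mx T.
Proof.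
rewrite /T preconditioned_systemE is_trig_block_mx // eqxx scalar_mx_is_trig.
by rewrite is_trig_block_mx // eqxx !scalar_mx_is_trig.
Qed.

Lemma preconditioned_lambda : T lambda_index lambda_index = a.
Proof.
rewrite /T preconditioned_systemE /lambda_index block_mxEdr block_mxEul.
by rewrite mxE eqxx.
Qed.

Lemma preconditioned_diag i : i != lambda_index -> T i i = 1.
Proof.
rewrite /T preconditioned_systemE; case: (split_ordP i) => j -> neq.
  by rewrite block_mxEul mxE eqxx.
rewrite block_mxEdr; case: (split_ordP j) neq => k ->; last first.
  by rewrite block_mxEdr mxE eqxx.
by rewrite [k]ord1 eqxx.
Qed.

Let N : 'M[R]_((n + n) + (1 + n)) :=
  block_mx 0 0 C (block_mx (a - 1)%:M 0 0 0).

Lemma preconditioned_eq1D : T = 1%:M + N.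
Proof.
rewrite /T preconditioned_systemE /N [in RHS]scalar_mx_block add_block_mx.
rewrite !add0r !addr0.
congr block_mx; rewrite scalar_mx_block add_block_mx !addr0 /E; congr block_mx.
by rewrite -raddfD /= addrC subrK.
Qed.

Lemma shifted_sqrE : N *m N = block_mx 0 0
  (block_mx (a - 1)%:M 0 0 0 *m C) (block_mx ((a - 1) ^+ 2)%:M 0 0 0).
Proof.
rewrite mulmx_block !(mulmx0, mul0mx, addr0, add0r) mulmx_block.
by rewrite !(mulmx0, mul0mx, addr0, add0r) -scalar_mxM -expr2.
Qed.

(** Only the [lambda] row of $N^2$ survives, and it is $a-1$ times that of [N]; one more factor [N]
    multiplies by $a-1$ again. With $N = T-1$ this reads $(T-1)^2(T-a)=0$. *)
Lemma shifted_cubeE : N *m N *m N = (a - 1) *: (N *m N).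
Proof.
rewrite shifted_sqrE mulmx_block !(mulmx0, mul0mx, addr0, add0r) mulmx_block.
rewrite !(mulmx0, mul0mx, addr0, add0r) -scalar_mxM scale_block_mx !scaler0.
rewrite scalemxAl !scale_block_mx !scaler0 !scale_scalar_mx -expr2.
by rewrite [_ ^+ 2 * _]mulrC.
Qed.

Lemma preconditioned_sqrE : T *m T = 1%:M + 2 *: N + N *m N.
Proof.
rewrite preconditioned_eq1D mulmxDl !mulmxDr !mul1mx mulmx1 addrA.
by rewrite scaler_nat mulr2n -!addrA.
Qed.

(** This is $(T-1)^2(T-a)=0$ expanded. *)
Lemma preconditioned_cubeE :
  T *m (T *m T) = (2 + a) *: (T *m T) - (1 + 2 * a) *: T + a *: 1%:M.
Proof.
have -> : T *m (T *m T) = 1%:M + 3 *: N + 3 *: (N *m N) + N *m N *m N.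
  rewrite preconditioned_sqrE preconditioned_eq1D mulmxDl mul1mx !mulmxDr mulmx1.
  rewrite -scalemxAr mulmxA.
  (* What remains is linear in the powers of [N], so with these as atoms it can be checked
     entrywise. *)
  set N2 := N *m N; set N3 := N2 *m N; move: 1%:M N2 N3 => I N2 N3.
  by apply/matrixP => i j; rewrite !mxE; ring.
rewrite shifted_cubeE preconditioned_sqrE preconditioned_eq1D.
move: 1%:M (N *m N) => I N2.
by apply/matrixP => i j; rewrite !mxE; ring.
Qed.

Lemma size_minpoly_le : (size (minpoly T) <= 4)%N.
Proof.
pose q : {poly R} := Poly [:: - a; 1 + 2 * a; - (2 + a); 1].
(* [Poly] strips trailing zeros; the leading 1 preserves all four coefficients. *)
have qE : q = [:: - a; 1 + 2 * a; - (2 + a); 1] :> seq R.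
  by rewrite (PolyK (c := 0)) //= oner_neq0.
have szq : size q = 4%N by rewrite qE.
rewrite -szq; apply: size_mxminpoly_castmx_le.
  by rewrite -size_poly_eq0 szq.
rewrite szq qE !big_ord_recl big_ord0 /= !mulmx1 preconditioned_cubeE.
move: 1%:M T (T *m T) => I A A2.
by apply/matrixP => i j; rewrite !mxE; ring.
Qed.

(** Independence of 1, [T], $T^2$ is that of 1, [N], $N^2$. The upper left block isolates the
    coefficient of 1, the [Lambda] rows that of [N], and the [lambda] row then gives $a-1$ times
    that of $N^2$. For $a = 1$ one has $N^2 = 0$ and the degree drops. *)
Lemma size_minpoly_eq : a != 1 -> size (minpoly T) = 4%N.
Proof.
move=> a1; apply/eqP; rewrite eqn_leq size_minpoly_le.
apply: size_mxminpoly_castmx_gt => f.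
rewrite !big_ord_recl big_ord0 /= !mulmx1 addr0.
set f0 := f _; set f1 := f _; set f2 := f _ => fT.
have i0 := Ordinal n_gt0.
have : (f0 + f1 + f2) *: 1%:M + (f1 + 2 * f2) *: N + f2 *: (N *m N) = 0.
  rewrite -[RHS]fT preconditioned_sqrE preconditioned_eq1D.
  move: 1%:M (N *m N) => I N2.
  by apply/matrixP => i j; rewrite !mxE; ring.
rewrite shifted_sqrE /N [1%:M]scalar_mx_block !scale_block_mx !add_block_mx.
rewrite -[RHS](block_mx0 _ (n + n) (1 + n) (n + n) (1 + n)).
case/eq_block_mx; rewrite !scaler0 !addr0 add0r => fI _ fC _.
have f012 : f0 + f1 + f2 = 0.
  have /matrixP/(_ (lshift n i0) (lshift n i0)) := fI.
  by rewrite !mxE eqxx mulr1.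
(* Multiplication by [calK K1] turns [C] into [Bmx m1], whose entries are explicit. *)
have : ((f1 + 2 * f2) *: C + f2 *: (block_mx (a - 1)%:M 0 0 0 *m C))
    *m calK K1 = 0.
  by rewrite fC mul0mx.
rewrite mulmxDl -!scalemxAl -mulmxA /C mulmxKV ?calK_unit // /Bmx mul_block_col.
rewrite !mul0mx !addr0 mul_scalar_mx !scale_col_mx add_col_mx scaler0 addr0.
rewrite -[RHS]col_mx0.
case/eq_col_mx => fB1 fB2.
have f12 : f1 + 2 * f2 = 0.
  have /matrixP/(_ i0 (lshift n i0)) := fB2.
  rewrite mxE row_mxEl !mxE eqxx mulr1n mulrN => /eqP.
  by rewrite oppr_eq0 mulf_eq0 [m1 _ _ == 0]gt_eqF ?m1pos // orbF => /eqP.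
have f20 : f2 = 0.
  have /matrixP/(_ ord0 (lshift n i0)) := fB1.
  rewrite f12 scale0r add0r 2!mxE row_mxEl !mxE => /eqP.
  rewrite !mulf_eq0 oppr_eq0 subr_eq0 (negPf a1) [m1 _ _ == 0]gt_eqF ?m1pos //.
  by rewrite !orbF => /eqP.
have f10 : f1 = 0 by move: f12; rewrite f20 mulr0 addr0.
have f00 : f0 = 0 by move: f012; rewrite f20 f10 !addr0.
case=> [[|[|[|k]]] ik] //; [rewrite -f00|rewrite -f10|rewrite -f20];
  by congr f; apply: val_inj.
Qed.

End Saddle.

(** * Cubes and Lebesgue measure in dimensions one to three *)

Section Chart.
Context {R : realType}.
Local Notation leb := (@lebesgue_measure R).

(* phi stands for the coordinate map from R, R * R or (R * R) * R in the
   definition of integral_Rd. Balls of 'rV[R]_d are cubes, as its norm is the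
   maximum norm, so their preimages are products of intervals. *)
Definition cube_chart d disp (T : measurableType disp)
    (mu : {measure set T -> \bar R}) (phi : T -> 'rV[R]_d) : Prop :=
  forall q r, 0 < r ->
    [/\ measurable (phi @^-1` ball q r), (0 < mu (phi @^-1` ball q r))%E
      & (mu (phi @^-1` ball q r) < +oo)%E].

Lemma ball_rowE d (q x : 'rV[R]_d) r : 0 < r ->
  ball q r x <-> forall i, ball (q 0 i) r (x 0 i).
Proof.
move=> r0; split=> [[_ qx] i|qx]; first exact: qx.
by split=> // i j; rewrite (ord1 i); exact: qx.
Qed.

Let leb_ball (c r : R) : 0 < r ->
  [/\ measurable (ball c r), (0 < leb (ball c r))%E & (leb (ball c r) < +oo)%E].
Proof.
move=> r0; split; first exact: measurable_ball.
  by rewrite lebesgue_measure_ball ?ltW // lte_fin mulrn_wgt0.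
by rewrite lebesgue_measure_ball ?ltW // ltry.
Qed.

Let prod_box disp (T : measurableType disp) (mu : {measure set T -> \bar R})
    (A : set T) (c r : R) : 0 < r ->
  [/\ measurable A, (0 < mu A)%E & (mu A < +oo)%E] ->
  [/\ measurable (A `*` ball c r), (0 < (mu \x leb) (A `*` ball c r))%E
    & ((mu \x leb) (A `*` ball c r) < +oo)%E].
Proof.
move=> r0 [mA A0 Aoo]; have [mB B0 Boo] := leb_ball c r0.
split; first exact: measurableX.
  by rewrite product_measure1E // mule_gt0.
by rewrite product_measure1E // lte_mul_pinfty // ?ltW // ge0_fin_numE // ltW.
Qed.

Let forall_ord2 (Q : 'I_2 -> Prop) : (forall i, Q i) <-> Q 0 /\ Q 1.
Proof.
split=> [//|[Q0 Q1] [[|[|k]] ik] //].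
- by rewrite (_ : Ordinal ik = 0) //; exact: val_inj.
- by rewrite (_ : Ordinal ik = 1) //; exact: val_inj.
Qed.

Let forall_ord3 (Q : 'I_3 -> Prop) : (forall i, Q i) <-> (Q 0 /\ Q 1) /\ Q 2.
Proof.
split=> [//|[[Q0 Q1] Q2] [[|[|[|k]]] ik] //].
- by rewrite (_ : Ordinal ik = 0) //; exact: val_inj.
- by rewrite (_ : Ordinal ik = 1) //; exact: val_inj.
- by rewrite (_ : Ordinal ik = 2) //; exact: val_inj.
Qed.

(** This removes the case distinction on [d]: later arguments know only [cube_chart] about the
    measure and the coordinate map. *)
Lemma integral_Rd_chart d : (1 <= d <= 3)%N ->
  exists (disp : measure_display) (T : measurableType disp)
    (mu : {measure set T -> \bar R}) (phi : T -> 'rV[R]_d),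
    cube_chart mu phi /\
    forall A f, integral_Rd A f = \int[mu]_(x in phi @^-1` A) f (phi x).
Proof.
case: d => [|[|[|[|d]]]] // _.
- exists _, _, leb, (fun x : R => point_of 1 [:: x]); split=> // q r r0.
  rewrite (_ : _ @^-1` _ = ball (q 0 0) r); first exact: leb_ball.
  apply/seteqP; split=> x /=; rewrite ball_rowE // => qx.
    by have := qx 0; rewrite mxE.
  by move=> i; rewrite (ord1 i) mxE.
- exists _, _, (leb \x leb)%E, (fun x : R * R => point_of 2 [:: x.1; x.2]).
  split=> // q r r0.
  rewrite (_ : _ @^-1` _ = ball (q 0 0) r `*` ball (q 0 1) r).
    exact/prod_box/leb_ball.
  by apply/seteqP; split=> x /=; rewrite ball_rowE // forall_ord2 !mxE.
- exists _, _, (leb \x leb \x leb)%E,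
    (fun x : R * R * R => point_of 3 [:: x.1.1; x.1.2; x.2]).
  split=> // q r r0.
  rewrite (_ : _ @^-1` _ = ball (q 0 0) r `*` ball (q 0 1) r `*` ball (q 0 2) r).
    by apply: prod_box => //; apply: prod_box => //; exact: leb_ball.
  by apply/seteqP; split=> x /=; rewrite ball_rowE // forall_ord3 !mxE.
Qed.

End Chart.

(** * Measurability of open sets and continuous functions through a chart *)

Section Measurability.
Context {R : realType} {d : nat} {disp : measure_display}
  {T : measurableType disp} {mu : {measure set T -> \bar R}}
  {phi : T -> 'rV[R]_d}.
Hypothesis phi_cube : cube_chart mu phi.

(* An open set is the countable union of the cubes with rational centre and
   radius 1/(k+1) that it contains. *)
Lemma measurable_preimage_open (U : set 'rV[R]_d) :
  open U -> measurable (phi @^-1` U).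
Proof.
move=> oU.
pose cube (c : 'rV[rat]_d * nat) : set 'rV[R]_d :=
  ball (map_mx ratr c.1 : 'rV[R]_d) (c.2.+1%:R^-1).
have r0 (k : nat) : 0 < (k.+1%:R^-1 : R) by rewrite invr_gt0.
(* Codes of no cube, or of a cube not inside [U], contribute the empty set. *)
pose F (k : nat) := if unpickle k is Some c then
  if `[< cube c `<=` U >] then cube c else set0 else set0.
have -> : U = \bigcup_k F k.
  apply/seteqP; split=> x; last first.
    case=> k _; rewrite /F; case: unpickle => // c.
    by case: asboolP => // cU /cU.
  move=> Ux; have /nbhs_ballP [e /= e0 xeU] := open_nbhs_nbhs (conj oU Ux).
  (* Half of [e], because two points of a cube are compared through its centre. *)
  have [k ke] : exists k : nat, k.+1%:R^-1 < e / 2.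
    have [k _ kP] := near_infty_natSinv_lt (PosNum (divr_gt0 e0 (ltr0n R 2))).
    by exists k; exact: kP (leqnn k).
  have /(_ _)/cid-/all_sig [c xc] (i : 'I_d) : exists q : rat,
      ball (ratr q : R) k.+1%:R^-1 (x 0 i).
    have /rat_in_itvoo [q] : x 0 i - k.+1%:R^-1 < x 0 i + k.+1%:R^-1.
      by rewrite ltrBlDr -addrA ltrDl addr_gt0.
    rewrite in_itv /= => qx; exists q.
    by rewrite /ball /= ltr_distl.
  have cx : ball (map_mx ratr (\row_i c i) : 'rV[R]_d) k.+1%:R^-1 x.
    by rewrite ball_rowE // => i; rewrite !mxE.
  exists (pickle (\row_i c i, k)) => //; rewrite /F pickleK.
  case: asboolP => // -[]; rewrite /cube /= => y cy; apply: xeU.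
  rewrite [e]splitr; apply: ball_triangle (ball_sym _) _;
    apply: le_ball (ltW ke) _ _; [exact: cx | exact: cy].
have PhiF k : measurable (phi @^-1` F k).
  rewrite /F; case: unpickle => [c|]; last by rewrite preimage_set0.
  case: asboolP => _; last by rewrite preimage_set0.
  by have [] := phi_cube (map_mx ratr c.1) (r0 c.2).
by rewrite preimage_bigcup; apply: bigcupT_measurable.
Qed.

(** Open intervals generate the Borel sets of the line, and their preimages within the open set [A]
    are open. *)
Lemma measurable_fun_continuous_in (A : set 'rV[R]_d) (f : 'rV[R]_d -> R) :
  open A -> {within closure A, continuous f} ->
  measurable_fun (phi @^-1` A) (f \o phi).
Proof.
move=> oA cf mA.
have cfA : {within A, continuous f}.
  by apply: continuous_subspaceW cf; exact: subset_closure.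
rewrite continuous_open_subspace // in cfA.
apply: (measurability _ (RGenOpens.measurableE R)) => //.
move=> _ [_ [a [b ->] <-]].
exact: (measurable_preimage_open
  ((continuous_inP _ oA).1 cfA _ (interval_open _ _))).
Qed.

End Measurability.

(** * Simplices and barycentric coordinates *)

Section Simplices.
Context {R : realType} {d : nat} {J : finType} (p : J -> 'rV[R]_d).
Implicit Types (t : {set J}) (x : 'rV[R]_d).

Lemma open_simplex_sub_closed t : open_simplex p t `<=` closed_simplex p t.
Proof. by move=> x [w [w0 w1 ->]]; exists w; split=> // j /w0/ltW. Qed.

Lemma closed_simplex_vertex t j : j \in t -> closed_simplex p t (p j).
Proof.
move=> jt; exists (fun i => (i == j)%:R); split=> [i _||]; first exact: ler0n.
  rewrite (bigD1 j) //= eqxx big1 ?addr0 // => i /andP [_ /negPf ->] //.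
rewrite (bigD1 j) //= eqxx scale1r big1 ?addr0 // => i /andP [_ /negPf ->].
by rewrite scale0r.
Qed.

Lemma affine_continuous (g : 'cV[R]_d) (c : R) :
  continuous (fun x => c + (x *m g) 0 0).
Proof.
have -> : (fun x => c + (x *m g) 0 0) = (fun x => c + \sum_i x 0 i * g i 0).
  by apply/funext => x; rewrite mxE.
have addc : continuous (fun z : R * R => z.1 + z.2) by exact: add_continuous.
have sumc : continuous (fun y : 'rV[R]_d => \sum_i y 0 i * g i 0).
  apply: (continuous_big addc) => i _ y.
  by apply: continuousM; [exact: coord_continuous | apply: cst_continuous].
by move=> x; apply: continuousD; [apply: cst_continuous | exact: sumc].
Qed.

(* The barycentric coordinates of x with respect to d + 1 affinely independent
   points are affine functions of x, hence continuous. *)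
Lemma open_simplex_open t : affinely_independent p t -> #|t| = d.+1 ->
  open (open_simplex p t).
Proof.
move=> indep td.
(* The rows are $(1, p_j)$: weights times [A] give the total weight and the weighted point, so
   affine independence is row freeness. *)
pose A : 'M[R]_(#|t|, 1 + d) := \matrix_i row_mx 1%:M (p (enum_val i)).
have wA (w : J -> R) : (\row_i w (enum_val i)) *m A =
    row_mx (\sum_(j in t) w j)%:M (\sum_(j in t) w j *: p j).
  apply/rowP => k; rewrite mxE; case: (split_ordP k) => l ->.
    rewrite row_mxEl [l]ord1 mxE eqxx mulr1n [RHS]big_enum_val /=.
    by apply: eq_bigr => i _; rewrite 2!mxE row_mxEl mxE eqxx mulr1.
  rewrite row_mxEr summxE [RHS]big_enum_val /=.
  by apply: eq_bigr => i _; rewrite 2!mxE row_mxEr mxE.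
have [j0 j0t] : exists j, j \in t by apply/card_gt0P; rewrite td.
pose rk := enum_rank_in j0t.
have rkK (v : 'rV[R]_#|t|) : v = \row_i v 0 (rk (enum_val i)).
  by apply/rowP => i; rewrite mxE /rk enum_valK_in.
have Afree : row_free A.
  apply/inj_row_free => v; rewrite [v]rkK (wA (fun j => v 0 (rk j))).
  rewrite -[RHS](row_mx0 _ 1 1 d) => /eq_row_mx [s0 p0].
  apply/rowP => i; rewrite mxE [RHS]mxE.
  apply: (indep (fun j => v 0 (rk j)) _ p0 _ (enum_valP i)).
  by have /matrixP/(_ 0 0) := s0; rewrite !mxE eqxx mulr1n.
(* [A] is square only up to the equation [td], so a one-sided inverse is taken and shown to be
   two-sided. *)
have /row_fullP [B BA] : row_full A.
  by rewrite /row_full (eqP Afree) td.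
have AB : A *m B = 1%:M.
  by apply: (row_free_inj Afree); rewrite -mulmxA BA mulmx1 mul1mx.
(* The barycentric coordinates of [x]. *)
pose W x : 'rV[R]_#|t| := row_mx 1%:M x *m B.
have WE i : (fun x => W x 0 i) =
    fun x => (usubmx B) 0 i + (x *m (col i (dsubmx B))) 0 0.
  apply/funext => x; rewrite /W -[B]vsubmxK mul_row_col mul1mx mxE col_mxKu.
  by rewrite col_mxKd colE mulmxA -colE !mxE.
have -> : open_simplex p t = [set x | forall i, 0 < W x 0 i].
  apply/seteqP; split=> x /=.
    case=> w [w0 w1 ->] i.
    have /(congr1 (fun M => M *m B)) := wA w.
    rewrite -mulmxA AB mulmx1 w1 => /esym; rewrite /W => ->.
    by rewrite mxE w0 // enum_valP.
  move=> Wx; have : W x *m A = row_mx 1%:M x by rewrite -mulmxA BA mulmx1.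
  rewrite [W x]rkK (wA (fun j => W x 0 (rk j))) => /eq_row_mx [s1 xE].
  exists (fun j => W x 0 (rk j)); split=> //.
  by have /matrixP/(_ 0 0) := s1; rewrite !mxE eqxx mulr1n.
rewrite openE => x Wx.
apply: (@filter_forall _ _ (fun i y => 0 < W y 0 i) (nbhs x)) => i.
have : {for x, continuous (fun x => W x 0 i)}.
  by rewrite WE; exact: affine_continuous.
by move/cvgr_gt => /(_ _ (Wx i)).
Qed.

End Simplices.

(** The difference quotient equals its limit for every nonzero [h]. *)
Lemma derive_affine {R : realType} {d : nat} (g : 'rV[R]_d) (c : R)
    (x v : 'rV[R]_d) :
  'D_v (fun y : 'rV[R]_d => \sum_k g 0 k * y 0 k + c) x = \sum_k g 0 k * v 0 k.
Proof.
apply: cvg_lim => //; apply: cvg_near_cst; near=> h.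
have h0 : h != 0 by near: h; exact: nbhs_dnbhs_neq.
rewrite /= opprD addrACA subrr addr0 -sumrB scaler_sumr; apply: eq_bigr => k _.
by rewrite !mxE mulrDr addrK mulrCA scalerA mulVf // scale1r.
Unshelve. all: by end_near.
Qed.

(** * Nodal basis functions, their gradients and the domain *)

Section FiniteElementFunctions.
Context {R : realType} {d : nat} {J : finType} {Omega : set 'rV[R]_d}
  {p : J -> 'rV[R]_d} {Th : {set {set J}}} {chi : J -> 'rV[R]_d -> R}.
Hypothesis hTh : regular_triangulation Omega p Th.
Hypothesis hchi : nodal_basis Omega p Th chi.

(** On a simplex [chi j] is affine, so its value is a convex combination of its vertex values, each
    0 or 1. *)
Lemma nodal_basis_range j x : closure Omega x -> 0 <= chi j x <= 1.
Proof.
rewrite (closure_domain hTh) => -[t tTh xt].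
have [g [c chiE]] := (hchi.1 j).2 t tTh.
rewrite chiE //; case: xt => w [w0 w1 ->].
have -> : \sum_k g 0 k * (\sum_(i in t) w i *: p i) 0 k + c =
    \sum_(i in t) w i * (i == j)%:R.
  rewrite -[c]mul1r -{1}w1 mulr_suml.
  under eq_bigr do rewrite summxE mulr_sumr.
  rewrite exchange_big -big_split /=; apply: eq_bigr => i it.
  rewrite -hchi.2 chiE; last exact: closed_simplex_vertex.
  rewrite mulrDr mulr_sumr; congr (_ + _); apply: eq_bigr => k _.
  by rewrite mxE mulrCA.
rewrite -{3}w1; apply/andP; split.
  by apply: sumr_ge0 => i it; rewrite mulr_ge0 ?w0.
by apply: ler_sum => i it; rewrite ler_piMr ?w0 // lern1 leq_b1.
Qed.

(** An open simplex is a neighbourhood of each of its points, so [v] may be replaced there by an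
    affine function before differentiating. *)
Lemma gradh_piecewise_cst v : Sh Omega p Th v ->
  exists G : {set J} -> 'rV[R]_d, forall t, t \in Th ->
    forall x, open_simplex p t x -> gradh p Th v x = G t.
Proof.
move=> [_ vaff].
have /(_ _)/cid-/all_sig [G GP] (t : {set J}) : exists g : 'rV[R]_d,
    t \in Th -> forall x, open_simplex p t x -> gradh p Th v x = g.
  have [tTh|] := boolP (t \in Th); last by exists 0.
  have [g [c vE]] := vaff t tTh; exists g => _ x xt.
  rewrite /gradh asboolT; last by exists t.
  apply/rowP => k; rewrite mxE.
  have -> : 'D_(delta_mx 0 k) v x =
      'D_(delta_mx 0 k) (fun y : 'rV[R]_d => \sum_k g 0 k * y 0 k + c) x.
    apply: near_eq_derive.
    have ot : open (open_simplex p t).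
      apply: open_simplex_open; first exact: simplex_nondeg hTh _ tTh.
      exact: simplex_card hTh _ tTh.
    have := open_nbhs_nbhs (conj ot xt); apply: filterS => y yt.
    by rewrite vE //; exact: open_simplex_sub_closed.
  rewrite derive_affine (bigD1 k) //= mxE !eqxx mulr1 big1 ?addr0 // => i ik.
  by rewrite mxE (negPf ik) andbF mulr0.
by exists G => t tTh x; exact: GP.
Qed.

Lemma domain_bounded : exists2 r : R, 0 < r & Omega `<=` ball (0 : 'rV[R]_d) r.
Proof.
(* A crude bound on all node coordinates, inherited by convex combinations; the radius is [C + 1]
   because balls are open. *)
pose C := \sum_j \sum_i `|p j 0 i|.
have pC j i : `|p j 0 i| <= C.
  rewrite /C (bigD1 j) //= (bigD1 i) //= -addrA lerDl addr_ge0 //.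
    exact: sumr_ge0.
  by apply: sumr_ge0 => k _; exact: sumr_ge0.
have C0 : 0 <= C by apply: sumr_ge0 => j _; exact: sumr_ge0.
exists (C + 1) => [|x Ox]; first by rewrite ltr_wpDl.
have : closure Omega x by exact: subset_closure.
rewrite (closure_domain hTh) => -[t tTh [w [w0 w1 ->]]].
rewrite ball_rowE ?ltr_wpDl // => i; rewrite mxE -ball_normE /= sub0r normrN.
rewrite ltr_pwDr // summxE (le_trans (ler_norm_sum _ _ _)) //.
rewrite -[C]mul1r -w1 mulr_suml; apply: ler_sum => j jt.
by rewrite mxE normrM ger0_norm ?w0 // ler_wpM2l ?w0.
Qed.

End FiniteElementFunctions.

(** * Integrals of bounded measurable functions and Gram forms *)

Section BoundedMeasurable.
Context {R : realType} {disp : measure_display} {T : measurableType disp}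
  (mu : {measure set T -> \bar R}) (A : set T).
Hypothesis mA : measurable A.
Hypothesis muA : (mu A < +oo)%E.
Implicit Types f g : T -> R.

(** On a set of finite measure this implies integrability and, unlike integrability, is stable under
    products. *)
Definition bounded_measurable f : Prop :=
  measurable_fun A f /\ exists M, forall x, A x -> `|f x| <= M.

Lemma bounded_measurable_integrable f :
  bounded_measurable f -> mu.-integrable A (EFin \o f).
Proof.
move=> [mf [M fM]]; apply: measurable_bounded_integrable => //.
exists M; split=> [|N MN x Ax]; first exact: num_real.
exact: le_trans (fM x Ax) (ltW MN).
Qed.

Lemma bounded_measurable_cst c : bounded_measurable (cst c).
Proof. by split; [exact: measurable_cst | exists `|c|]. Qed.

Lemma bounded_measurableD f g : bounded_measurable f -> bounded_measurable g ->
  bounded_measurable (fun x => f x + g x).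
Proof.
move=> [mf [M fM]] [mg [N gN]]; split; first exact: measurable_funD.
exists (M + N) => x Ax; apply: le_trans (ler_normD _ _) _.
by rewrite lerD ?fM ?gN.
Qed.

Lemma bounded_measurableM f g : bounded_measurable f -> bounded_measurable g ->
  bounded_measurable (fun x => f x * g x).
Proof.
move=> [mf [M fM]] [mg [N gN]]; split; first exact: measurable_funM.
by exists (M * N) => x Ax; rewrite normrM ler_pM ?fM ?gN.
Qed.

Lemma bounded_measurable_sum (I : finType) (f : I -> T -> R) :
  (forall i, bounded_measurable (f i)) ->
  bounded_measurable (fun x => \sum_i f i x).
Proof.
move=> bf; elim: index_enum => [|i s IH].
  by under eq_fun do rewrite big_nil; exact: bounded_measurable_cst.
by under eq_fun do rewrite big_cons; exact: bounded_measurableD.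
Qed.

Lemma Rintegral_sum (I : finType) (f : I -> T -> R) :
  (forall i, bounded_measurable (f i)) ->
  \int[mu]_(x in A) (\sum_i f i x) = \sum_i \int[mu]_(x in A) f i x.
Proof.
move=> bf.
(* The induction carries boundedness along, as additivity requires the tail to be integrable. *)
suff /(_ (index_enum I)) [_ ->//] : forall s : seq I,
    bounded_measurable (fun x => \sum_(i <- s) f i x) /\
    \int[mu]_(x in A) (\sum_(i <- s) f i x) =
    \sum_(i <- s) \int[mu]_(x in A) f i x.
elim=> [|i s [bs IH]].
  split; first by under eq_fun do rewrite big_nil; exact: bounded_measurable_cst.
  rewrite big_nil; under eq_Rintegral do rewrite big_nil.
  by rewrite Rintegral_cst // mul0r.
split; first by under eq_fun do rewrite big_cons; exact: bounded_measurableD.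
rewrite big_cons -IH; under eq_Rintegral do rewrite big_cons.
by rewrite RintegralD //; exact: bounded_measurable_integrable.
Qed.

(* The left-hand side is the quadratic form at u of the Gram matrix of the
   vector fields g_i, that is the integral of |sum_i u_i g_i|^2. *)
Lemma gram_form_ge0 (I K : finType) (u : I -> R) (g : I -> K -> T -> R) :
  (forall i k, bounded_measurable (g i k)) ->
  0 <= \sum_i \sum_j u i * u j * \int[mu]_(x in A) (\sum_k g j k x * g i k x).
Proof.
move=> bg.
have bgg i j : bounded_measurable (fun x => \sum_k g j k x * g i k x).
  by apply: bounded_measurable_sum => k; exact: bounded_measurableM.
have buu i j : bounded_measurable
    (fun x => u i * u j * (\sum_k g j k x * g i k x)).
  by apply: bounded_measurableM (bgg i j); exact: bounded_measurable_cst.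
suff -> : \sum_i \sum_j u i * u j * \int[mu]_(x in A) (\sum_k g j k x * g i k x)
    = \int[mu]_(x in A) (\sum_k (\sum_i u i * g i k x) ^+ 2).
  by apply: Rintegral_ge0 => x _; apply: sumr_ge0 => k _; exact: sqr_ge0.
under eq_bigr => i _.
  under eq_bigr => j _ do rewrite -RintegralZl ?bounded_measurable_integrable //.
  rewrite -Rintegral_sum //.
  over.
rewrite -Rintegral_sum => [|i]; last exact: bounded_measurable_sum.
apply: eq_Rintegral => x _.
(* Bringing the sum over [k] outermost exposes a square for each component. *)
under eq_bigr => i _ do under eq_bigr => j _ do rewrite mulr_sumr.
under eq_bigr => i _ do rewrite exchange_big.
rewrite exchange_big; apply: eq_bigr => k _ /=.
rewrite expr2 mulr_suml; apply: eq_bigr => i _.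
by rewrite mulr_sumr; apply: eq_bigr => j _; ring.
Qed.

End BoundedMeasurable.

(** * Lumped mass and stiffness matrices *)

Section Matrices.
Context {R : realType} {d : nat} {J : finType} {Omega : set 'rV[R]_d}
  {p : J -> 'rV[R]_d} {Th : {set {set J}}} {chi : J -> 'rV[R]_d -> R}.
Hypothesis hd : (1 <= d <= 3)%N.
Hypothesis hTh : regular_triangulation Omega p Th.
Hypothesis hchi : nodal_basis Omega p Th chi.

Section Charted.
Context {disp : measure_display} {T : measurableType disp}
  {mu : {measure set T -> \bar R}} {phi : T -> 'rV[R]_d}.
Hypothesis phi_cube : cube_chart mu phi.
Local Notation A := (phi @^-1` Omega).

Lemma measurable_domain : measurable A.
Proof. exact: (measurable_preimage_open phi_cube (domain_open hTh)). Qed.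

Lemma domain_lty : (mu A < +oo)%E.
Proof.
have [r r0 Or] := domain_bounded hTh; have [mB _ Boo] := phi_cube 0 r0.
apply: le_lt_trans Boo; apply: le_measure; rewrite ?inE //.
  exact: measurable_domain.
by move=> x /Or.
Qed.

Let mA := measurable_domain.
Let muA := domain_lty.

Lemma basis_bounded_measurable j : bounded_measurable A (chi j \o phi).
Proof.
split.
  exact: (measurable_fun_continuous_in phi_cube (domain_open hTh) (hchi.1 j).1).
exists 1 => x Ax; have /andP [c0 c1] : 0 <= chi j (phi x) <= 1.
  by apply: nodal_basis_range hTh hchi _ _ _; exact: subset_closure.
by rewrite /= ger0_norm.
Qed.

(* The node p_i lies in the closure of the open set Omega and chi_i(p_i) = 1,
   so chi_i > 1/2 on some cube inside Omega. *)
Lemma Rintegral_basis_gt0 i : 0 < \int[mu]_(x in A) (chi i \o phi) x.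
Proof.
have [t tTh it] := nodes_cover hTh i.
have pcl : closure Omega (p i).
  by rewrite (closure_domain hTh); exists t => //; exact: closed_simplex_vertex.
have [cchi _] := hchi.1 i.
have half1 : 2^-1 < 1 :> R by lra.
have oU : open (Omega `&` chi i @^-1` [set y | 2^-1 < y]).
  have cO : {within Omega, continuous (chi i)}.
    by apply: continuous_subspaceW cchi; exact: subset_closure.
  rewrite (continuous_open_subspace _ (domain_open hTh)) in cO.
  apply: (continuous_inP _ (domain_open hTh)).1 cO _ _; exact: open_gt.
have [y [Oy ygt]] : exists y, Omega y /\ 2^-1 < chi i y.
  have : \forall y \near within (closure Omega) (nbhs (p i)), 2^-1 < chi i y.
    have cp : chi i y @[y --> (p i : subspace (closure Omega))] --> chi i (p i).
      exact: cchi.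
    rewrite hchi.2 eqxx in cp.
    by rewrite nbhs_subspace_in //; move/cvgr_gt: cp; apply.
  rewrite near_withinE => /pcl [y [Oy yP]]; exists y; split=> //.
  by apply: yP; exact: subset_closure.
have /nbhs_ballP [e /= e0 eU] := open_nbhs_nbhs (conj oU (conj Oy ygt)).
pose B := phi @^-1` ball y e.
have [mB B0 Boo] := phi_cube y e0.
have BA : B `<=` A by move=> x /eU [].
have [mf [M fM]] := basis_bounded_measurable i.
have intA := bounded_measurable_integrable mA muA (basis_bounded_measurable i).
have bB : bounded_measurable B (chi i \o phi).
  by split; [exact: measurable_funS mA BA mf | exists M => x /BA /fM].
(* The cube contributes at least half its measure, the rest of the domain at least 0. *)
rewrite -(setDUK BA) Rintegral_setU //; last 3 first.
- exact: measurableD.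
- by rewrite setDUK.
- by apply/disj_setPS => x [Bx []].
have : 2^-1 * fine (mu B) <= \int[mu]_(x in B) (chi i \o phi) x.
  rewrite -Rintegral_cst //; apply: le_Rintegral => //.
  - exact: bounded_measurable_integrable (bounded_measurable_cst _ _).
  - exact: bounded_measurable_integrable bB.
  - by move=> x /eU [_ /ltW].
have : 0 < fine (mu B) by rewrite fine_gt0 // B0.
have : 0 <= \int[mu]_(x in A `\` B) (chi i \o phi) x.
  apply: Rintegral_ge0 => x [Ax _].
  by have /andP [] := nodal_basis_range hTh hchi i (subset_closure Ax).
lra.
Qed.

(** [gradh] has one constant value on each of finitely many measurable open simplices and is 0
    elsewhere by convention. *)
Lemma gradh_bounded_measurable v k : Sh Omega p Th v ->
  bounded_measurable A (fun x => gradh p Th v (phi x) 0 k).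
Proof.
move=> /(gradh_piecewise_cst hTh) [G GP].
pose f x := gradh p Th v (phi x) 0 k.
pose O t := phi @^-1` open_simplex p t.
have mO t : t \in Th -> measurable (O t).
  move=> tTh; apply: (measurable_preimage_open phi_cube); apply: open_simplex_open.
    exact: simplex_nondeg hTh _ tTh.
  exact: simplex_card hTh _ tTh.
pose U := \big[setU/set0]_(t in Th) O t.
have f0 x : ~ U x -> f x = 0.
  move=> Ux; rewrite /f /gradh asboolF ?mxE // => -[t tTh xt].
  by apply: Ux; rewrite /U (bigD1 t) //=; left.
have [mU mfU] : measurable U /\ measurable_fun U f.
  rewrite /U; apply: (big_ind (fun E => measurable E /\ measurable_fun E f)).
  - by split; [exact: measurable0 | exact: measurable_fun_set0].
  - move=> E F [mE fE] [mF fF]; split; first exact: measurableU.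
    exact/measurable_funU.
  - move=> t tTh; split; first exact: mO.
    apply: (eq_measurable_fun (cst (G t 0 k))); last exact: measurable_cst.
    by move=> x /set_mem xt; rewrite /f (GP t tTh).
split.
  (* The domain is enlarged to a union of two pieces on each of which [f] is already understood. *)
  apply: (@measurable_funS _ _ _ _ (U `|` (A `\` U))).
  - by apply: measurableU => //; exact: measurableD.
  - by move=> x Ax; have [|] := pselect (U x); [left | right].
  apply/measurable_funU => //; first exact: measurableD.
  split; first exact: mfU.
  apply: (eq_measurable_fun (cst (0 : R))); last exact: measurable_cst.
  by move=> x /set_mem [_ Ux]; exact/esym/f0.
exists (\sum_(t in Th) `|G t 0 k|) => x _; rewrite -/(f x).
have [[t tTh xt]|nU] := pselect (exists2 t, t \in Th & open_simplex p t (phi x)).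
  by rewrite /f (GP t tTh) // (bigD1 t) //= lerDl sumr_ge0.
by rewrite /f /gradh asboolF // mxE normr0 sumr_ge0.
Qed.

End Charted.

(** Interpolation sees only nodal values, where the product is nonzero at a common node alone; hence
    the lumped mass matrix is diagonal with entries $\int\chi_i$. *)
Lemma interp_basis i j x :
  interp p chi (fun y => chi i y * chi j y) x = (i == j)%:R * chi i x.
Proof.
rewrite /interp (bigD1 i) //= big1 ?addr0 => [|k ki].
  by rewrite !hchi.2 eqxx mul1r.
by rewrite !hchi.2 (negPf ki) !mul0r.
Qed.

Lemma mass_offdiag i j : i != j -> mass Omega p chi i j = 0.
Proof.
move=> /negPf ij.
have [disp [T [mu [phi [_ intE]]]]] := integral_Rd_chart (R := R) hd.
rewrite /mass /lumped_product intE.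
under eq_Rintegral do rewrite interp_basis ij mul0r.
by rewrite /Rintegral integral0.
Qed.

Lemma mass_diag_gt0 i : 0 < mass Omega p chi i i.
Proof.
have [disp [T [mu [phi [phi_cube intE]]]]] := integral_Rd_chart (R := R) hd.
rewrite /mass /lumped_product intE.
under eq_Rintegral do rewrite interp_basis eqxx mul1r.
exact: Rintegral_basis_gt0.
Qed.

(** A Gram form of gradients; [node] is to be the numbering [enum_val] of the interface nodes. *)
Lemma stiffness_form_ge0 (I : finType) (node : I -> J) (u : I -> R) :
  0 <= \sum_i \sum_j u i * u j * stiffness Omega p Th chi (node i) (node j).
Proof.
have [disp [T [mu [phi [phi_cube intE]]]]] := integral_Rd_chart (R := R) hd.
rewrite /stiffness.
under eq_bigr => i _ do under eq_bigr => j _ do rewrite intE.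
apply: (gram_form_ge0 (measurable_domain phi_cube) (domain_lty phi_cube) u
  (g := fun i k x => gradh p Th (chi (node i)) (phi x) 0 k)) => i k.
exact: (gradh_bounded_measurable phi_cube _ (hchi.1 _)).
Qed.

Lemma lumped_vec_gt0 (D : {set J}) i : 0 < lumped_vec Omega p chi D i 0.
Proof. by rewrite mxE mass_diag_gt0. Qed.

(** The lumped mass part is a positive diagonal form and the stiffness part is nonnegative. *)
Lemma calK1_posdef (eps tau : R) (D : {set J}) : 0 < eps -> 0 < tau ->
  posdef (calK1 Omega p Th chi eps tau D).
Proof.
move=> eps0 tau0 u u0.
have -> : (u^T *m calK1 Omega p Th chi eps tau D *m u) 0 0 =
    eps ^+ 2 / tau *
      (\sum_i u i 0 ^+ 2 * mass Omega p chi (enum_val i) (enum_val i)) +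
    eps ^+ 2 * (\sum_i \sum_j u i 0 * u j 0 *
      stiffness Omega p Th chi (enum_val i) (enum_val j)).
  rewrite -mulmxA mxE !mulr_sumr -big_split /=; apply: eq_bigr => i _.
  rewrite !mxE.
  (* Vanishing off-diagonal masses let the single sum become a double one, to be merged with the
     stiffness form. *)
  have -> : u i 0 ^+ 2 * mass Omega p chi (enum_val i) (enum_val i) =
      \sum_j u i 0 * u j 0 * mass Omega p chi (enum_val i) (enum_val j).
    rewrite (bigD1 i) //= big1 ?addr0 // => j ji.
    by rewrite mass_offdiag ?mulr0 // (inj_eq enum_val_inj) eq_sym.
  rewrite !mulr_sumr -big_split /=; apply: eq_bigr => j _.
  by rewrite !mxE; ring.
rewrite ltr_wpDr //.
  by apply: mulr_ge0; [exact: sqr_ge0 | exact: stiffness_form_ge0].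
rewrite mulr_gt0 // ?divr_gt0 ?exprn_gt0 //.
have /rV0Pn [i ui] : u^T != 0 by rewrite -trmx0 (inj_eq trmx_inj).
rewrite (bigD1 i) //= ltr_wpDr //.
  by apply: sumr_ge0 => j _; rewrite mulr_ge0 ?sqr_ge0 ?ltW ?mass_diag_gt0.
by rewrite mulr_gt0 ?mass_diag_gt0 // exprn_even_gt0 //=; rewrite mxE in ui.
Qed.

End Matrices.

Theorem theorem3p1 (R : realType) (d : nat) (hd : (1 <= d <= 3)%N)
  (J : finType) (Omega : set 'rV[R]_d) (p : J -> 'rV[R]_d)
  (Th : {set {set J}}) (hTh : regular_triangulation Omega p Th)
  (chi : J -> 'rV[R]_d -> R) (hchi : nodal_basis Omega p Th chi)
  (eps tau : R) (heps : 0 < eps) (htau : 0 < tau)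
  (I1 I2 : {set J}) (hD : I1 :&: I2 != finset.set0) :
  let D := (I1 :&: I2)%SET in
  let K1 := calK1 Omega p Th chi eps tau D in
  let m1 := lumped_vec Omega p chi D in
  let K := Kmx K1 m1 in
  let P2 := precond K1 m1 (S2 K1 m1) in
  let P3 := precond K1 m1 (S3 K1 m1) in
  let a := acoef K1 m1 in
  [/\ inverses_exist K1 m1,
      P2 = P3
    & forall P, P = P2 \/ P = P3 ->
      let T := K *m invmx P in
      [/\ is_trig_mx T,
          (forall i, i != lambda_index -> T i i = 1)
          /\ T lambda_index lambda_index = a,
          (a != 1 -> (size (minpoly T)).-1 = 3%N),
          ((size (minpoly T)).-1 <= 3)%N
        & gmres_converges_within K P 3%N]].
Proof.
move=> D K1 m1 K P2 P3 a.
have n_gt0 : (0 < #|D|)%N by rewrite card_gt0.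
have K1pos : posdef K1 by exact: calK1_posdef.
have m1pos i : 0 < m1 i 0 by exact: lumped_vec_gt0 hd hTh hchi _ _.
have P23 : P2 = P3 by rewrite /P2 /P3 S2E // S3E.
split=> // [|P PE]; first exact: inverses_existP.
have {PE} -> : P = P2 by case: PE => ->.
rewrite /P2 S2E //; split.
- exact: preconditioned_trig.
- by split; [exact: preconditioned_diag | exact: preconditioned_lambda].
- by move=> a1; rewrite size_minpoly_eq.
- by rewrite -subn1 leq_subLR; exact: size_minpoly_le.
have a0 : a != 0 by rewrite gt_eqF // acoef_gt0.
(* Dividing $T^3-(2+a)T^2+(1+2a)T=a$ by [a] expresses 1 through $T, T^2, T^3$ with these
   coefficients. *)
pose c (i : 'I_3) := [:: (1 + 2 * a) / a; - (2 + a) / a; a^-1]`_i.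
apply: (@gmres_converges_polynomial_inverse _ _ _ _ 3 c).
  exact: precond_unit.
rewrite !big_ord_recl big_ord0 /= !mulmx1 /c /= preconditioned_cubeE // -/a.
move: a a0 {c} => a a0; set T := Kmx _ _ *m _.
move: 1%:M T (T *m T) => I T T2.
by apply/matrixP => i j; rewrite !mxE; field.
Qed.
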